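(* Let $M$ be a commutative monoid. The category $\mathcal{H}(M)$ of systems of abelian groups over $M$ is equivalent to the category of abelian group objects in the slice category $\mathbf{CM}/M$.
   Context: $\mathbf{CM}/M$ is the slice category over $M$ of the category of commutative monoids: objects are monoid homomorphisms $p:D\to M$, morphisms are homomorphisms over $M$; its terminal object is $\mathrm{id}_M$ and products are fibre products over $M$. An abelian group object in a category with finite products is an object $G$ with morphisms $\mu:G\times G\to G$, $\nu:G\to G$, $e:\mathbf{1}\to G$ satisfying the abelian group axioms as commutative diagrams; morphisms are those compatible with this structure. A system of abelian groups $\mathcal{A}$ over $M$ is a functor to abelian groups from the category $\mathbb{H}(M)$ with objects the elements of $M$ and morphisms $a\to b$ the pairs $(r,a)$, $r\in M$, with $b=ra$ (composition by multiplication); i.e. an abelian group $\mathcal{A}(a)$ for each $a\in M$ and homomorphisms $r_*:\mathcal{A}(a)\to\mathcal{A}(ra)$ for all $r,a\in M$ with $1_*=\mathrm{id}$ and $(rs)_*=r_*\circ s_*$. Morphisms in $\mathcal{H}(M)$ are natural transformations. *)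

(* Defs.v *)
From HB Require Import structures.
From mathcomp Require Import all_boot all_algebra.
From mathcomp Require Import boolp.

(* Commutative monoids and abelian groups are [nmodType]s and [zmodType]s, and
   are therefore written additively: the product [r a] of the monoid [M] is
   [r + a] and its unit is [0].  Homomorphisms are [{additive _ -> _}]; they
   need not respect the choice operators that these structures also carry, so
   that every bijective homomorphism is an isomorphism. *)

Set Implicit Arguments.
Unset Strict Implicit.
Unset Printing Implicit Defensive.

Import GRing.Theory.
Local Open Scope ring_scope.

Record category := Category {
  obj :> Type;
  hom : obj -> obj -> Type;
  idm : forall a, hom a a;
  comp : forall a b c, hom b c -> hom a b -> hom a c;
  comp_idl : forall a b (f : hom a b), comp (idm b) f = f;
  comp_idr : forall a b (f : hom a b), comp f (idm a) = f;
  comp_assoc : forall a b c d (h : hom c d) (g : hom b c) (f : hom a b),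
    comp h (comp g f) = comp (comp h g) f }.

Arguments hom {C} a b : rename.
Arguments idm {C} a : rename.
Arguments comp {C a b c} g f : rename.

Notation "g \oc f" := (comp g f) (at level 40, left associativity).

Definition isomorphic (C : category) (a b : C) : Prop :=
  exists (f : hom a b) (g : hom b a), g \oc f = idm a /\ f \oc g = idm b.

Record functor (C D : category) := Functor {
  fobj :> C -> D;
  fmap : forall a b, hom a b -> hom (fobj a) (fobj b);
  fmap_id : forall a, fmap (idm a) = idm (fobj a);
  fmap_comp : forall a b c (g : hom b c) (f : hom a b),
    fmap (g \oc f) = fmap g \oc fmap f }.

Arguments fmap {C D} f {a b} g : rename.

Definition id_functor (C : category) : functor C C :=
  @Functor C C id (fun _ _ => id) (fun _ => erefl) (fun _ _ _ _ _ => erefl).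

Section CompFunctor.
Variables (C D E : category) (G : functor D E) (F : functor C D).

Fact comp_functor_id a : fmap G (fmap F (idm a)) = idm (G (F a)).
Proof. by rewrite !fmap_id. Qed.

Fact comp_functor_comp a b c (g : hom b c) (f : hom a b) :
  fmap G (fmap F (g \oc f)) = fmap G (fmap F g) \oc fmap G (fmap F f).
Proof. by rewrite !fmap_comp. Qed.

Definition comp_functor : functor C E :=
  @Functor C E (fun a => G (F a)) (fun a b f => fmap G (fmap F f))
    comp_functor_id comp_functor_comp.
End CompFunctor.

Record nat_trans (C D : category) (F G : functor C D) := NatTrans {
  component :> forall a, hom (F a) (G a);
  naturality : forall a b (f : hom a b),
    component b \oc fmap F f = fmap G f \oc component a }.

Lemma nat_trans_eq (C D : category) (F G : functor C D) (s t : nat_trans F G) :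
  (forall a, s a = t a) -> s = t.
Proof.
case: s t => [s Hs] [t Ht] /= st.
have {}st : s = t by apply: functional_extensionality_dep.
by case: t / st Ht => Ht; congr NatTrans; apply: Prop_irrelevance.
Qed.

Section FunctorCategory.
Variables C D : category.

Fact nat_id_natural (F : functor C D) a b (f : hom a b) :
  idm (F b) \oc fmap F f = fmap F f \oc idm (F a).
Proof. by rewrite comp_idl comp_idr. Qed.

Fact nat_comp_natural (F G H : functor C D) (t : nat_trans G H)
    (s : nat_trans F G) a b (f : hom a b) :
  (t b \oc s b) \oc fmap F f = fmap H f \oc (t a \oc s a).
Proof. by rewrite -comp_assoc naturality !comp_assoc naturality. Qed.

Definition nat_id F := NatTrans (@nat_id_natural F).
Definition nat_comp F G H t s := NatTrans (@nat_comp_natural F G H t s).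

Fact nat_comp_idl F G (s : nat_trans F G) : nat_comp (nat_id G) s = s.
Proof. by apply: nat_trans_eq => a; apply: comp_idl. Qed.

Fact nat_comp_idr F G (s : nat_trans F G) : nat_comp s (nat_id F) = s.
Proof. by apply: nat_trans_eq => a; apply: comp_idr. Qed.

Fact nat_comp_assoc F G H K (u : nat_trans H K) (t : nat_trans G H)
    (s : nat_trans F G) :
  nat_comp u (nat_comp t s) = nat_comp (nat_comp u t) s.
Proof. by apply: nat_trans_eq => a; apply: comp_assoc. Qed.

Definition functor_cat : category :=
  Category nat_comp_idl nat_comp_idr nat_comp_assoc.
End FunctorCategory.

Definition equivalent (C D : category) : Prop :=
  exists (F : functor C D) (G : functor D C),
    @isomorphic (functor_cat C C) (comp_functor G F) (id_functor C) /\
    @isomorphic (functor_cat D D) (comp_functor F G) (id_functor D).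

Record finite_products (C : category) := FiniteProducts {
  one : C;
  bang : forall a, hom a one;
  bang_uniq : forall a (f : hom a one), f = bang a;
  prd : C -> C -> C;
  pr1 : forall a b, hom (prd a b) a;
  pr2 : forall a b, hom (prd a b) b;
  pairing : forall a b c, hom c a -> hom c b -> hom c (prd a b);
  pr1_pairing : forall a b c (f : hom c a) (g : hom c b),
    pr1 a b \oc pairing f g = f;
  pr2_pairing : forall a b c (f : hom c a) (g : hom c b),
    pr2 a b \oc pairing f g = g;
  pairing_uniq : forall a b c (h : hom c (prd a b)),
    h = pairing (pr1 a b \oc h) (pr2 a b \oc h) }.

Arguments bang {C} f a : rename.
Arguments pr1 {C f a b} : rename.
Arguments pr2 {C f a b} : rename.
Arguments pairing {C f a b c} h k : rename.

Section AbelianGroupObjects.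
Variables (C : category) (P : finite_products C).
Local Notation "1" := (one P).
Local Notation "a * b" := (prd P a b).
Local Notation "<| f , g |>" := (pairing (f := P) f g).

Definition prd_map (a b a' b' : C) (f : hom a a') (g : hom b b') :
    hom (a * b) (a' * b') :=
  <| f \oc pr1, g \oc pr2 |>.

Definition prd_assoc (a b c : C) : hom ((a * b) * c) (a * (b * c)) :=
  <| pr1 \oc pr1, <| pr2 \oc pr1, pr2 |> |>.

Record ab_object := AbObject {
  ab_carrier :> C;
  ab_mu : hom (ab_carrier * ab_carrier) ab_carrier;
  ab_nu : hom ab_carrier ab_carrier;
  ab_e : hom 1 ab_carrier;
  ab_muA : ab_mu \oc prd_map ab_mu (idm ab_carrier) =
    ab_mu \oc prd_map (idm ab_carrier) ab_mu \oc
      prd_assoc ab_carrier ab_carrier ab_carrier;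
  ab_mu1l : ab_mu \oc <| ab_e \oc bang P ab_carrier, idm ab_carrier |> =
    idm ab_carrier;
  ab_mu1r : ab_mu \oc <| idm ab_carrier, ab_e \oc bang P ab_carrier |> =
    idm ab_carrier;
  ab_muVl : ab_mu \oc <| ab_nu, idm ab_carrier |> = ab_e \oc bang P ab_carrier;
  ab_muVr : ab_mu \oc <| idm ab_carrier, ab_nu |> = ab_e \oc bang P ab_carrier;
  ab_muC : ab_mu \oc <| pr2, pr1 |> = ab_mu }.

Record ab_hom (G H : ab_object) := AbHom {
  ab_map :> hom (ab_carrier G) (ab_carrier H);
  ab_map_mu : ab_map \oc ab_mu G = ab_mu H \oc prd_map ab_map ab_map;
  ab_map_nu : ab_map \oc ab_nu G = ab_nu H \oc ab_map;
  ab_map_e : ab_map \oc ab_e G = ab_e H }.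

Lemma ab_hom_eq (G H : ab_object) (f g : ab_hom G H) :
  ab_map f = ab_map g -> f = g.
Proof.
case: f g => [f f1 f2 f3] [g g1 g2 g3] /= fg.
by case: g / fg g1 g2 g3 => *; congr AbHom; apply: Prop_irrelevance.
Qed.

Lemma pairing_comp (a b c d : C) (f : hom c a) (g : hom c b) (h : hom d c) :
  <| f, g |> \oc h = <| f \oc h, g \oc h |>.
Proof.
by rewrite [LHS]pairing_uniq !comp_assoc pr1_pairing pr2_pairing.
Qed.

Lemma prd_map_id (a b : C) : prd_map (idm a) (idm b) = idm (a * b).
Proof. by rewrite [RHS]pairing_uniq /prd_map !comp_idl !comp_idr. Qed.

Lemma prd_map_comp (a b a' b' a'' b'' : C) (f' : hom a' a'') (g' : hom b' b'')
    (f : hom a a') (g : hom b b') :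
  prd_map (f' \oc f) (g' \oc g) = prd_map f' g' \oc prd_map f g.
Proof.
by rewrite /prd_map pairing_comp -!comp_assoc pr1_pairing pr2_pairing.
Qed.

Definition ab_idm (G : ab_object) : ab_hom G G.
Proof.
exists (idm (ab_carrier G)).
- by rewrite prd_map_id comp_idl comp_idr.
- by rewrite comp_idl comp_idr.
- by rewrite comp_idl.
Defined.

Definition ab_comp (G H K : ab_object) (g : ab_hom H K) (f : ab_hom G H) :
  ab_hom G K.
Proof.
exists (ab_map g \oc ab_map f).
- by rewrite prd_map_comp -comp_assoc ab_map_mu !comp_assoc ab_map_mu.
- by rewrite -comp_assoc ab_map_nu !comp_assoc ab_map_nu.
- by rewrite -comp_assoc !ab_map_e.
Defined.

Fact ab_comp_idl G H (f : ab_hom G H) : ab_comp (ab_idm H) f = f.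
Proof. by apply: ab_hom_eq; apply: comp_idl. Qed.

Fact ab_comp_idr G H (f : ab_hom G H) : ab_comp f (ab_idm G) = f.
Proof. by apply: ab_hom_eq; apply: comp_idr. Qed.

Fact ab_comp_assoc G H K L (h : ab_hom K L) (g : ab_hom H K) (f : ab_hom G H) :
  ab_comp h (ab_comp g f) = ab_comp (ab_comp h g) f.
Proof. by apply: ab_hom_eq; apply: comp_assoc. Qed.

Definition ab_object_cat : category :=
  Category ab_comp_idl ab_comp_idr ab_comp_assoc.
End AbelianGroupObjects.

Section Slice.
Variables (C : category) (X : C).

Record slice_obj := SliceObj {
  slice_dom : C;
  slice_map : hom slice_dom X }.

Record slice_hom (p q : slice_obj) := SliceHom {
  slice_fun :> hom (slice_dom p) (slice_dom q);
  slice_over : slice_map q \oc slice_fun = slice_map p }.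

Lemma slice_hom_eq (p q : slice_obj) (f g : slice_hom p q) :
  slice_fun f = slice_fun g -> f = g.
Proof.
case: f g => [f Hf] [g Hg] /= fg.
by case: g / fg Hg => *; congr SliceHom; apply: Prop_irrelevance.
Qed.

Definition slice_idm (p : slice_obj) : slice_hom p p :=
  SliceHom (comp_idr (slice_map p)).

Fact slice_comp_over (p q r : slice_obj) (g : slice_hom q r)
  (f : slice_hom p q) :
  slice_map r \oc (slice_fun g \oc slice_fun f) = slice_map p.
Proof. by rewrite comp_assoc !slice_over. Qed.

Definition slice_comp p q r g f := SliceHom (@slice_comp_over p q r g f).

Fact slice_comp_idl p q (f : slice_hom p q) : slice_comp (slice_idm q) f = f.
Proof. by apply: slice_hom_eq; apply: comp_idl. Qed.

Fact slice_comp_idr p q (f : slice_hom p q) : slice_comp f (slice_idm p) = f.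
Proof. by apply: slice_hom_eq; apply: comp_idr. Qed.

Fact slice_comp_assoc p q r s (h : slice_hom r s) (g : slice_hom q r)
    (f : slice_hom p q) :
  slice_comp h (slice_comp g f) = slice_comp (slice_comp h g) f.
Proof. by apply: slice_hom_eq; apply: comp_assoc. Qed.

Definition slice : category :=
  Category slice_comp_idl slice_comp_idr slice_comp_assoc.
End Slice.

Lemma additive_eq (U V : nmodType) (f g : {additive U -> V}) : f =1 g -> f = g.
Proof.
case: f g => [f [[Hf]]] [g [[Hg]]] /= /funext fg.
by case: g / fg Hg => Hg; rewrite (Prop_irrelevance Hf Hg).
Qed.

Definition cm_idm (U : nmodType) : {additive U -> U} := idfun.
Definition cm_comp (U V W : nmodType) (g : {additive V -> W})
  (f : {additive U -> V}) : {additive U -> W} := g \o f.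

Fact cm_comp_idl (U V : nmodType) (f : {additive U -> V}) :
  cm_comp (cm_idm V) f = f.
Proof. exact: additive_eq. Qed.

Fact cm_comp_idr (U V : nmodType) (f : {additive U -> V}) :
  cm_comp f (cm_idm U) = f.
Proof. exact: additive_eq. Qed.

Fact cm_comp_assoc (U V W Z : nmodType) (h : {additive W -> Z})
    (g : {additive V -> W}) (f : {additive U -> V}) :
  cm_comp h (cm_comp g f) = cm_comp (cm_comp h g) f.
Proof. exact: additive_eq. Qed.

Definition CM : category :=
  @Category nmodType (fun U V => {additive U -> V}) cm_idm cm_comp
    cm_comp_idl cm_comp_idr cm_comp_assoc.

Definition Ab : category :=
  @Category zmodType (fun U V => {additive U -> V})
    (fun U => cm_idm U) (fun U V W g f => cm_comp g f)
    (fun U V f => cm_comp_idl f) (fun U V f => cm_comp_idr f)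
    (fun U V W Z h g f => cm_comp_assoc h g f).

Section FibreProduct.
Variables (M D E : nmodType) (p : {additive D -> M}) (q : {additive E -> M}).

Definition fibre_pred : {pred D * E} := fun x => p x.1 == q x.2.

Fact fibre_pred_closed : GRing.nmod_closed fibre_pred.
Proof.
rewrite /fibre_pred; split=> [|x y]; rewrite !unfold_in /=.
  by rewrite !raddf0.
by move=> /eqP px /eqP py; rewrite !raddfD px py.
Qed.

Record fibre_product := FibreProduct {
  fibre_val :> D * E;
  fibre_valP : fibre_val \in fibre_pred }.

HB.instance Definition _ := [isSub for fibre_val].
HB.instance Definition _ := [Choice of fibre_product by <:].
HB.instance Definition _ :=
  GRing.SubChoice_isSubNmodule.Build _ _ fibre_product fibre_pred_closed.

Definition fibre_fst (x : fibre_product) : D := (val x).1.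
Definition fibre_snd (x : fibre_product) : E := (val x).2.

Fact fibre_fst_additive : GRing.nmod_morphism fibre_fst.
Proof. by []. Qed.
HB.instance Definition _ :=
  GRing.isNmodMorphism.Build _ _ fibre_fst fibre_fst_additive.

Fact fibre_snd_additive : GRing.nmod_morphism fibre_snd.
Proof. by []. Qed.
HB.instance Definition _ :=
  GRing.isNmodMorphism.Build _ _ fibre_snd fibre_snd_additive.

Definition fibre_pr1 : {additive fibre_product -> D} := fibre_fst.
Definition fibre_pr2 : {additive fibre_product -> E} := fibre_snd.

Lemma fibre_eq (x : fibre_product) : p (fibre_fst x) = q (fibre_snd x).
Proof. exact/eqP/(valP x). Qed.

Lemma fibre_productP (x y : fibre_product) :
  fibre_fst x = fibre_fst y -> fibre_snd x = fibre_snd y -> x = y.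
Proof.
rewrite /fibre_fst /fibre_snd => xy1 xy2; apply: val_inj.
by rewrite [LHS]surjective_pairing xy1 xy2 -surjective_pairing.
Qed.

Section Pairing.
Variables (Z : nmodType) (f : {additive Z -> D}) (g : {additive Z -> E}).
Hypothesis fg : forall z, p (f z) = q (g z).

Fact fibre_pair_proof z : (f z, g z) \in fibre_pred.
Proof. by rewrite unfold_in /=; apply/eqP. Qed.

Definition fibre_pair_fun z := FibreProduct (fibre_pair_proof z).

Fact fibre_pair_additive : GRing.nmod_morphism fibre_pair_fun.
Proof.
by split=> [|x y]; apply: fibre_productP; rewrite /fibre_fst /fibre_snd /=
  ?raddf0 ?raddfD.
Qed.
HB.instance Definition _ :=
  GRing.isNmodMorphism.Build _ _ fibre_pair_fun fibre_pair_additive.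

Definition fibre_pair : {additive Z -> fibre_product} := fibre_pair_fun.
End Pairing.
End FibreProduct.

Section SliceProducts.
Variable M : nmodType.
Local Notation CMM := (@slice CM M).

Definition cm_slice_one : CMM := @SliceObj CM M M (cm_idm M).

Fact cm_slice_bang_over (D : CMM) :
  cm_comp (cm_idm M) (slice_map D) = slice_map D.
Proof. exact: cm_comp_idl. Qed.

Definition cm_slice_bang (D : CMM) : slice_hom D cm_slice_one :=
  @SliceHom CM M D cm_slice_one (slice_map D) (cm_slice_bang_over D).

Fact cm_slice_bang_uniq (D : CMM) (f : slice_hom D cm_slice_one) :
  f = cm_slice_bang D.
Proof.
apply: slice_hom_eq; rewrite /= -(slice_over f) /=.
by rewrite cm_comp_idl.
Qed.

Definition cm_slice_prd (D E : CMM) : CMM :=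
  @SliceObj CM M (fibre_product (slice_map D) (slice_map E) : nmodType)
    (cm_comp (slice_map D) (fibre_pr1 (slice_map D) (slice_map E))).

Definition cm_slice_pr1 (D E : CMM) : slice_hom (cm_slice_prd D E) D :=
  @SliceHom CM M (cm_slice_prd D E) D
    (fibre_pr1 (slice_map D) (slice_map E)) erefl.

Fact cm_slice_pr2_over (D E : CMM) :
  cm_comp (slice_map E) (fibre_pr2 (slice_map D) (slice_map E)) =
  slice_map (cm_slice_prd D E).
Proof. by apply: additive_eq => x /=; rewrite fibre_eq. Qed.

Definition cm_slice_pr2 (D E : CMM) : slice_hom (cm_slice_prd D E) E :=
  @SliceHom CM M (cm_slice_prd D E) E
    (fibre_pr2 (slice_map D) (slice_map E)) (cm_slice_pr2_over D E).

Section Pairing.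
Variables (D E Z : CMM) (f : slice_hom Z D) (g : slice_hom Z E).

Fact cm_slice_pairing_proof z :
  slice_map D (slice_fun f z) = slice_map E (slice_fun g z).
Proof.
have /(congr1 (fun h : {additive _ -> _} => h z)) /= -> := slice_over f.
by have /(congr1 (fun h : {additive _ -> _} => h z)) /= -> := slice_over g.
Qed.

Fact cm_slice_pairing_over :
  cm_comp (slice_map (cm_slice_prd D E)) (fibre_pair cm_slice_pairing_proof) =
  slice_map Z.
Proof. by rewrite -(slice_over f); apply: additive_eq. Qed.

Definition cm_slice_pairing : slice_hom Z (cm_slice_prd D E) :=
  @SliceHom CM M Z (cm_slice_prd D E) (fibre_pair cm_slice_pairing_proof)
    cm_slice_pairing_over.
End Pairing.

Fact cm_slice_pr1_pairing (D E Z : CMM) (f : slice_hom Z D)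
    (g : slice_hom Z E) :
  slice_comp (cm_slice_pr1 D E) (cm_slice_pairing f g) = f.
Proof. by apply: slice_hom_eq; apply: additive_eq. Qed.

Fact cm_slice_pr2_pairing (D E Z : CMM) (f : slice_hom Z D)
    (g : slice_hom Z E) :
  slice_comp (cm_slice_pr2 D E) (cm_slice_pairing f g) = g.
Proof. by apply: slice_hom_eq; apply: additive_eq. Qed.

Fact cm_slice_pairing_uniq (D E Z : CMM) (h : slice_hom Z (cm_slice_prd D E)) :
  h = cm_slice_pairing (slice_comp (cm_slice_pr1 D E) h)
        (slice_comp (cm_slice_pr2 D E) h).
Proof.
by apply: slice_hom_eq; apply: additive_eq => z; apply: fibre_productP.
Qed.

Definition cm_slice_products : finite_products CMM :=
  @FiniteProducts CMM cm_slice_one cm_slice_bang cm_slice_bang_uniq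
    cm_slice_prd cm_slice_pr1 cm_slice_pr2 cm_slice_pairing
    cm_slice_pr1_pairing cm_slice_pr2_pairing cm_slice_pairing_uniq.
End SliceProducts.

Section Systems.
Variable M : nmodType.

Definition Hhom (a b : M) := {r : M | b == r + a}.

Definition Hidm (a : M) : Hhom a a := exist _ 0 (introT eqP (esym (add0r a))).

Fact Hcomp_proof (a b c : M) (r : Hhom b c) (s : Hhom a b) :
  c == (val r + val s) + a.
Proof. by rewrite -addrA -(eqP (valP s)) (valP r). Qed.

Definition Hcomp (a b c : M) (r : Hhom b c) (s : Hhom a b) : Hhom a c :=
  exist _ (val r + val s) (Hcomp_proof r s).

Fact Hcomp_idl (a b : M) (r : Hhom a b) : Hcomp (Hidm b) r = r.
Proof. by apply: val_inj; apply: add0r. Qed.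

Fact Hcomp_idr (a b : M) (r : Hhom a b) : Hcomp r (Hidm a) = r.
Proof. by apply: val_inj; apply: addr0. Qed.

Fact Hcomp_assoc (a b c d : M) (t : Hhom c d) (s : Hhom b c) (r : Hhom a b) :
  Hcomp t (Hcomp s r) = Hcomp (Hcomp t s) r.
Proof. by apply: val_inj; apply: addrA. Qed.

Definition Hcat : category := Category Hcomp_idl Hcomp_idr Hcomp_assoc.

Definition systems : category := functor_cat Hcat Ab.
End Systems.

(* Main.v *)
From HB Require Import structures.
From mathcomp Require Import all_boot all_algebra.
From mathcomp Require Import boolp.
Require Import Defs.

Set Implicit Arguments.
Unset Strict Implicit.
Unset Printing Implicit Defensive.

(** A system [A] is assembled into one monoid over [M], and an abelian group
    object is cut into its fibres; the two constructions are inverse up to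
    natural isomorphism.

    From [A], take the disjoint union of the groups [A(a)], with projection
    to the index.  The sum of [x] over [a] and [y] over [b] is
    [b_* x + a_* y], formed in [A(a + b)]; functoriality of [A] makes this a
    commutative monoid.  Fibrewise addition, opposite and zero are monoid
    homomorphisms over [M] because every [r_*] is additive, so the union is
    an abelian group object ([total_ab]).

    From an abelian group object [G] with zero section [e], take the fibres
    of the projection, which are abelian groups under the operations of [G],
    with [r_* x = e(r) + x] ([fibre_system]).  This map is additive because
    the multiplication [mu] of [G] is itself a monoid homomorphism:
    [mu(e(r) + x, e(r) + y) = mu(e(r), e(r)) + mu(x, y) = e(r) + mu(x, y)].

    The fibre over [a] of the union of a system is [A(a)], giving
    [fibre_unit].  Conversely the fibres of [G] exhaust its underlying monoid;
    the point to check is that the sum rebuilt from the fibres is the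
    original one, and this is the interchange law again
    ([space_mu_shift]):
    [mu(e(b) + x, e(a) + y) = mu(x, e(a)) + mu(e(b), y) = x + y].
    Both comparison maps are bijective homomorphisms, hence isomorphisms. *)

Import GRing.Theory.
Local Open Scope ring_scope.

(** * Detecting isomorphisms *)

Definition invertible (C : category) (a b : C) (f : hom a b) : Prop :=
  exists g : hom b a, g \oc f = idm a /\ f \oc g = idm b.

Lemma isomorphic_of_invertible (C : category) (a b : C) (f : hom a b) :
  invertible f -> isomorphic a b /\ isomorphic b a.
Proof. by move=> [g [gf fg]]; split; [exists f, g | exists g, f]. Qed.

(** The pointwise inverses, once chosen, are natural because [t] is. *)
Lemma nat_trans_invertible (C D : category) (F G : functor C D)
    (t : nat_trans F G) :
  (forall a, invertible (t a)) -> @invertible (functor_cat C D) F G t.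
Proof.
move=> t_inv; pose s a := sval (cid (t_inv a)).
have st a : s a \oc t a = idm (F a) by case: (svalP (cid (t_inv a))).
have ts a : t a \oc s a = idm (G a) by case: (svalP (cid (t_inv a))).
have s_nat a b (f : hom a b) : s b \oc fmap G f = fmap F f \oc s a.
  rewrite -[LHS]comp_idr -(ts a) -comp_assoc [fmap G f \oc _]comp_assoc.
  by rewrite -naturality !comp_assoc st comp_idl.
by exists (NatTrans s_nat); split; apply: nat_trans_eq => a /=.
Qed.

(** Composing each compatibility equation of [f] with the inverse on both sides
    gives the same equation for the inverse. *)
Lemma ab_hom_invertible (C : category) (P : finite_products C)
    (G H : ab_object P) (f : ab_hom G H) :
  invertible (ab_map f) -> @invertible (ab_object_cat P) G H f.
Proof.
move=> [g [gf fg]].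
have g_mu : g \oc ab_mu H = ab_mu G \oc prd_map P g g.
  rewrite -[LHS]comp_idr -(prd_map_id P) -fg prd_map_comp.
  rewrite -comp_assoc [ab_mu H \oc _]comp_assoc -ab_map_mu.
  by rewrite !comp_assoc gf comp_idl.
have g_nu : g \oc ab_nu H = ab_nu G \oc g.
  rewrite -[LHS]comp_idr -fg -comp_assoc [ab_nu H \oc _]comp_assoc.
  by rewrite -ab_map_nu !comp_assoc gf comp_idl.
have g_e : g \oc ab_e H = ab_e G.
  by rewrite -(ab_map_e f) comp_assoc gf comp_idl.
by exists (AbHom g_mu g_nu g_e); split; apply: ab_hom_eq.
Qed.

Lemma slice_hom_invertible (C : category) (X : C) (p q : slice_obj X)
    (f : slice_hom p q) :
  invertible (slice_fun f) -> @invertible (slice X) p q f.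
Proof.
move=> [g [gf fg]].
have g_over : slice_map p \oc g = slice_map q.
  by rewrite -(slice_over f) -comp_assoc fg comp_idr.
by exists (SliceHom g_over); split; apply: slice_hom_eq.
Qed.

Lemma additive_app (U V : nmodType) (f g : {additive U -> V}) : f = g -> f =1 g.
Proof. by move=> ->. Qed.

Lemma slice_homP (M : nmodType) (p q : slice (M : CM)) (f g : hom p q) :
  f = g ->
  (slice_fun f : {additive _ -> _}) =1 (slice_fun g : {additive _ -> _}).
Proof. by move=> ->. Qed.

(** This spares every comparison map below the verification that its inverse
    is a homomorphism. *)
Lemma additive_inverse (U V : nmodType) (f : {additive U -> V}) (g : V -> U) :
  cancel f g -> cancel g f -> exists g' : {additive V -> U}, g' =1 g.
Proof.
move=> fK gK.
have g_add : GRing.nmod_morphism g.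
  split=> [|x y]; first by rewrite -(raddf0 f) fK.
  by apply: (can_inj fK); rewrite raddfD !gK.
pose gA := GRing.isNmodMorphism.Build _ _ g g_add.
by exists (HB.pack_for {additive V -> U} g gA).
Qed.

Lemma CM_invertible (U V : CM) (f : hom U V)
    (g : (V : nmodType) -> (U : nmodType)) :
  cancel (f : {additive _ -> _}) g -> cancel g (f : {additive _ -> _}) ->
  invertible f.
Proof.
move=> fK gK; have [g' g'E] := additive_inverse fK gK.
by exists g'; split; apply: additive_eq => x /=; rewrite g'E.
Qed.

Lemma Ab_invertible (U V : Ab) (f : hom U V)
    (g : (V : zmodType) -> (U : zmodType)) :
  cancel (f : {additive _ -> _}) g -> cancel g (f : {additive _ -> _}) ->
  invertible f.
Proof.
move=> fK gK; have [g' g'E] := additive_inverse fK gK.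
by exists g'; split; apply: additive_eq => x /=; rewrite g'E.
Qed.

(** * The action in a system of abelian groups *)

Section SystemAction.
Variables (M : nmodType) (A : systems M).
Implicit Types a b c r : M.

Definition value a : zmodType := fobj (A : functor _ _) a.

(** Taking an arbitrary proof of [b = r + a], rather than fixing [b] to be
    [r + a], lets an arrow end at an element that is only provably [r + a];
    with [r = 0] arrows serve as transports along equalities. *)
Definition arrow a b r (h : b = r + a) : Hhom a b := exist _ r (introT eqP h).

Definition act a b (t : Hhom a b) : {additive value a -> value b} :=
  fmap (A : functor _ _) t.
Local Arguments act {a b} t.

Lemma act_loop a (t : Hhom a a) (x : value a) : val t = 0 -> act t x = x.
Proof.
move=> t0; have -> : t = Hidm a by apply: val_inj.
by rewrite /act (fmap_id (A : functor _ _) a).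
Qed.

Lemma act_comp a b c (t : Hhom b c) (s : Hhom a b) (x : value a) :
  act t (act s x) = act (Hcomp t s) x.
Proof. by rewrite /act (fmap_comp (A : functor _ _) t s). Qed.

Lemma act_eq a b (s t : Hhom a b) (x : value a) :
  val s = val t -> act s x = act t x.
Proof. by move=> /val_inj ->. Qed.

End SystemAction.
Arguments act {M A a b} t.

(** * From systems to abelian group objects *)

Section TotalMonoid.
Variables (M : nmodType) (A : systems M).
Implicit Types a b : M.

Definition total := {a : M & value A a}.
HB.instance Definition _ := Choice.on total.

Definition point a (x : value A a) : total := existT _ a x.

(** Equality of dependent pairs without casts: the transport between the two
    fibres is the action of an arrow of value [0], so that functoriality alone
    proves the equations in [total]. *)
Lemma point_eq a b (t : Hhom a b) (x : value A a) (y : value A b) :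
  val t = 0 -> act t x = y -> point x = point y.
Proof.
move=> t0; have ab : b = a by rewrite (eqP (valP t)) t0 add0r.
by case: a / ab t x t0 => t x t0; rewrite act_loop // => ->.
Qed.

Definition total_zero : total := point (0 : value A 0).

Definition total_add (u v : total) : total :=
  point (act (arrow (addrC (tag u) (tag v))) (tagged u) +
         act (arrow (erefl (tag u + tag v))) (tagged v)).

Fact total_addA : associative total_add.
Proof.
move=> [a x] [b y] [c z].
apply: (@point_eq _ _ (arrow (esym (etrans (add0r _) (addrA a b c))))) => //=.
rewrite !raddfD /= !act_comp -[RHS]addrA.
congr (_ + (_ + _)); apply: act_eq => /=.
- by rewrite add0r addrC.
- by rewrite add0r addrC.
- by rewrite !add0r.
Qed.

Fact total_addC : commutative total_add.
Proof.
move=> [a x] [b y].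
apply: (@point_eq _ _ (arrow (esym (etrans (add0r _) (addrC a b))))) => //=.
rewrite raddfD /= !act_comp [LHS]addrC.
by congr (_ + _); apply: act_eq => /=; rewrite add0r.
Qed.

Fact total_add0 : left_id total_zero total_add.
Proof.
move=> [a x].
apply: (@point_eq _ _ (arrow (esym (etrans (add0r _) (add0r a))))) => //=.
by rewrite raddf0 [X in act _ X]add0r act_comp act_loop //= addr0.
Qed.

HB.instance Definition _ :=
  GRing.isNmodule.Build total total_addA total_addC total_add0.

Definition base (u : total) : M := tag u.

Fact base_additive : GRing.nmod_morphism base.
Proof. by []. Qed.

HB.instance Definition _ :=
  GRing.isNmodMorphism.Build total M base base_additive.

Definition total_over : slice (M : CM) :=
  @SliceObj CM M (total : nmodType) (base : {additive total -> M}).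

Definition pairs : nmodType :=
  fibre_product (base : {additive total -> M}) (base : {additive total -> M}).

Fact same_base (w : pairs) : tag (fibre_fst w) = 0 + tag (fibre_snd w).
Proof. by rewrite add0r; apply: (fibre_eq w). Qed.

Definition total_mu (w : pairs) : total :=
  point (tagged (fibre_fst w) +
         act (arrow (same_base w)) (tagged (fibre_snd w))).

(** The transport built into [total_mu] disappears once both components are
    written over the same base point. *)
Lemma total_muE (w : pairs) a (x y : value A a) :
  fibre_fst w = point x -> fibre_snd w = point y -> total_mu w = point (x + y).
Proof.
rewrite /total_mu; move: (same_base w).
case: (fibre_fst w) (fibre_snd w) => [b x'] [c y'] /= bc.
move=> /[dup] /(congr1 tag) /= ba; case: a / ba x y => x y.
move=> /eqP; rewrite -tag_eqE /tag_eq eqxx /= tagged_asE => /eqP ->.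
move=> /[dup] /(congr1 tag) /= cb; case: b / cb x x' y bc => x x' y bc.
move=> /eqP; rewrite -tag_eqE /tag_eq eqxx /= tagged_asE => /eqP ->.
by rewrite act_loop.
Qed.

Lemma pairsP (w : pairs) : exists a (x y : value A a),
  fibre_fst w = point x /\ fibre_snd w = point y.
Proof.
have := same_base w.
case: (fibre_fst w) (fibre_snd w) => [b x] [c y] /= bc.
exists b, x, (act (arrow bc) y); split=> //.
exact: (point_eq (t := arrow bc)).
Qed.

Fact total_mu_additive : GRing.nmod_morphism total_mu.
Proof.
split=> [|w w'].
  by rewrite (total_muE (x := 0 : value A 0) (y := 0)) ?addr0.
have [a [x [y [wx wy]]]] := pairsP w; have [b [x' [y' [wx' wy']]]] := pairsP w'.
rewrite (total_muE wx wy) (total_muE wx' wy').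
pose plus (u : value A a) (v : value A b) : value A (a + b) :=
  act (arrow (addrC a b)) u + act (arrow (erefl (a + b))) v.
rewrite (total_muE (x := plus x x') (y := plus y y')).
- by congr point => /=; rewrite /plus !raddfD addrACA.
- by rewrite raddfD /= wx wx'.
- by rewrite raddfD /= wy wy'.
Qed.

HB.instance Definition _ :=
  GRing.isNmodMorphism.Build pairs total total_mu total_mu_additive.

Definition total_nu (u : total) : total := point (- tagged u).

Fact total_nu_additive : GRing.nmod_morphism total_nu.
Proof.
split=> [|u v]; first by rewrite /total_nu oppr0.
by congr point => /=; rewrite opprD !raddfN.
Qed.

HB.instance Definition _ :=
  GRing.isNmodMorphism.Build total total total_nu total_nu_additive.

Definition total_e (a : M) : total := point (0 : value A a).

Fact total_e_additive : GRing.nmod_morphism total_e.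
Proof. by split=> [//|a b]; congr point => /=; rewrite !raddf0 addr0. Qed.

HB.instance Definition _ :=
  GRing.isNmodMorphism.Build M total total_e total_e_additive.

Local Notation P := (cm_slice_products M).

Definition mu_over :
  @hom (slice (M : CM)) (prd P total_over total_over) total_over.
Proof.
exists (total_mu : {additive pairs -> total}).
by apply: additive_eq.
Defined.

Definition nu_over : @hom (slice (M : CM)) total_over total_over.
Proof.
exists (total_nu : {additive total -> total}).
by apply: additive_eq.
Defined.

Definition e_over : @hom (slice (M : CM)) (one P) total_over.
Proof.
exists (total_e : {additive M -> total}).
by apply: additive_eq.
Defined.

Lemma over_point a (u : total) :
  base u = a -> exists x : value A a, u = point x.
Proof. by case: u => b x /= ab; case: a / ab; exists x. Qed.

Definition total_ab : ab_object P.
Proof.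
apply: (@AbObject _ P total_over mu_over nu_over e_over);
  apply: slice_hom_eq; apply: additive_eq.
- move=> w; have [a [x [y [wx wy]]]] := pairsP (fibre_fst w).
  have [z wz] : exists z : value A a, fibre_snd w = point z.
    apply: over_point; apply: etrans (esym (fibre_eq w)) _.
    exact: (congr1 base wx).
  apply: etrans (@total_muE _ a (x + y) z _ _) _.
  - exact: (total_muE wx wy).
  - exact: wz.
  rewrite -addrA; apply/esym/(@total_muE _ a x (y + z)); first exact: wx.
  by apply: (@total_muE _ a y z); [exact: wy | exact: wz].
- by move=> [a x]; apply: etrans (@total_muE _ a 0 x _ _) _; rewrite ?add0r.
- by move=> [a x]; apply: etrans (@total_muE _ a x 0 _ _) _; rewrite ?addr0.
- by move=> [a x]; apply: etrans (@total_muE _ a (- x) x _ _) _; rewrite ?addNr.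
- by move=> [a x]; apply: etrans (@total_muE _ a x (- x) _ _) _; rewrite ?addrN.
- move=> w; have [a [x [y [wx wy]]]] := pairsP w.
  apply: etrans (@total_muE _ a y x _ _) _; [exact: wy | exact: wx |].
  by rewrite addrC; apply/esym/total_muE.
Defined.

End TotalMonoid.

Section TotalMap.
Variables (M : nmodType) (A B : systems M) (s : hom A B).

Definition value_map a : {additive value A a -> value B a} :=
  component (s : nat_trans _ _) a.

Lemma value_map_act a b (t : Hhom a b) (x : value A a) :
  value_map b (act t x) = act t (value_map a x).
Proof. exact: (additive_app (naturality (s : nat_trans _ _) t) x). Qed.

Definition total_map (u : total A) : total B :=
  point (value_map (tag u) (tagged u)).

Fact total_map_additive : GRing.nmod_morphism total_map.
Proof.
split=> [|u v]; first by rewrite /total_map raddf0.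
by congr point; rewrite raddfD /= !value_map_act.
Qed.

HB.instance Definition _ :=
  GRing.isNmodMorphism.Build (total A) (total B) total_map total_map_additive.

Definition total_slice_map :
  @hom (slice (M : CM)) (total_over A) (total_over B).
Proof.
exists (total_map : {additive total A -> total B}).
by apply: additive_eq.
Defined.

Definition total_ab_map : ab_hom (total_ab A) (total_ab B).
Proof.
exists total_slice_map; apply: slice_hom_eq; apply: additive_eq.
- move=> w; have [a [x [y [wx wy]]]] := pairsP w.
  apply: etrans (congr1 total_map (total_muE wx wy)) _.
  rewrite /total_map /= raddfD; apply/esym/total_muE.
    exact: (congr1 total_map wx).
  exact: (congr1 total_map wy).
- by move=> [a x]; congr point; rewrite raddfN.
- by move=> a; congr point; rewrite raddf0.
Defined.
End TotalMap.

Section TotalFunctor.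
Variable M : nmodType.

Fact total_ab_map_id (A : systems M) :
  total_ab_map (idm A) = idm (total_ab A : ab_object_cat _).
Proof. by apply: ab_hom_eq; apply: slice_hom_eq; apply: additive_eq => -[]. Qed.

Fact total_ab_map_comp (A B C : systems M) (t : hom B C) (s : hom A B) :
  total_ab_map (t \oc s) =
  (total_ab_map t : hom (_ : ab_object_cat _) _) \oc total_ab_map s.
Proof. by apply: ab_hom_eq; apply: slice_hom_eq; apply: additive_eq => -[]. Qed.

Definition total_functor :
    functor (systems M) (ab_object_cat (cm_slice_products M)) :=
  @Functor (systems M) (ab_object_cat (cm_slice_products M))
    (@total_ab M) (@total_ab_map M) total_ab_map_id total_ab_map_comp.
End TotalFunctor.

(** * From abelian group objects to systems *)

Section Fibres.
Variable M : nmodType.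
Local Notation P := (cm_slice_products M).
Variable G : ab_object P.

Definition space : nmodType := slice_dom (ab_carrier G).
Definition proj : {additive space -> M} := slice_map (ab_carrier G).
Definition space_mu : {additive fibre_product proj proj -> space} :=
  slice_fun (ab_mu G).
Definition space_nu : {additive space -> space} := slice_fun (ab_nu G).
Definition space_e : {additive M -> space} := slice_fun (ab_e G).

Lemma proj_mu w : proj (space_mu w) = proj (fibre_fst w).
Proof. exact: (additive_app (slice_over (ab_mu G)) w). Qed.

Lemma proj_nu x : proj (space_nu x) = proj x.
Proof. exact: (additive_app (slice_over (ab_nu G)) x). Qed.

Lemma proj_e a : proj (space_e a) = a.
Proof. exact: (additive_app (slice_over (ab_e G)) a). Qed.

(** Two points of a fibre product with the same coordinates may carry different
    proofs of membership, hence differ syntactically. *)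
Lemma space_mu_eq (u v : fibre_product proj proj) :
  fibre_fst u = fibre_fst v -> fibre_snd u = fibre_snd v ->
  space_mu u = space_mu v.
Proof. by move=> uv1 uv2; rewrite (fibre_productP uv1 uv2). Qed.

Definition pair_over (x y : space) (h : proj x = proj y) :
  fibre_product proj proj :=
  @FibreProduct _ _ _ proj proj (x, y) (introT eqP h).

Lemma space_mu0l x h : space_mu (@pair_over (space_e (proj x)) x h) = x.
Proof.
apply: etrans _ (slice_homP (ab_mu1l G) x).
exact: space_mu_eq.
Qed.

Lemma space_mu0r x h : space_mu (@pair_over x (space_e (proj x)) h) = x.
Proof.
apply: etrans _ (slice_homP (ab_mu1r G) x).
exact: space_mu_eq.
Qed.

Definition fibre (a : M) := {x : space | proj x == a}.
HB.instance Definition _ a := Choice.on (fibre a).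

Section FibreGroup.
Variable a : M.
Implicit Types x y z : fibre a.

Fact fibre_pair_over x y : proj (val x) = proj (val y).
Proof. by rewrite (eqP (valP x)) (eqP (valP y)). Qed.

Definition fibre_add x y : fibre a.
Proof.
exists (space_mu (pair_over (fibre_pair_over x y))).
by rewrite proj_mu (eqP (valP x)).
Defined.

Definition fibre_opp x : fibre a.
Proof. by exists (space_nu (val x)); rewrite proj_nu (eqP (valP x)). Defined.

Definition fibre_zero : fibre a.
Proof. by exists (space_e a); rewrite proj_e. Defined.

Fact fibre_addA : associative fibre_add.
Proof.
move=> x y z; apply: val_inj; apply: esym.
pose xy := pair_over (fibre_pair_over x y).
have xyz : slice_map (prd P (ab_carrier G) (ab_carrier G)) xy = proj (val z).
  exact: fibre_pair_over.
pose w := @FibreProduct _ _ _ _ proj (xy, val z) (introT eqP xyz).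
apply: etrans _ (etrans (slice_homP (ab_muA G) w) _).
  exact: space_mu_eq.
by apply: space_mu_eq => //=; apply: space_mu_eq.
Qed.

Fact fibre_addC : commutative fibre_add.
Proof.
move=> x y; apply: val_inj.
pose w := pair_over (fibre_pair_over x y).
apply: etrans (esym (slice_homP (ab_muC G) w)) _.
exact: space_mu_eq.
Qed.

Fact fibre_add0 : left_id fibre_zero fibre_add.
Proof.
move=> x; apply: val_inj; apply: etrans _ (slice_homP (ab_mu1l G) (val x)).
apply: space_mu_eq => //; exact: (congr1 space_e (esym (eqP (valP x)))).
Qed.

Fact fibre_addN : left_inverse fibre_zero fibre_opp fibre_add.
Proof.
move=> x; apply: val_inj.
apply: etrans _ (etrans (slice_homP (ab_muVl G) (val x)) _).
  exact: space_mu_eq.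
exact: (congr1 space_e (eqP (valP x))).
Qed.

HB.instance Definition _ := GRing.isZmodule.Build (fibre a)
  fibre_addA fibre_addC fibre_add0 fibre_addN.
End FibreGroup.

Section FibreAction.
Variables (a b : M) (t : Hhom a b).

Fact fibre_act_over (x : fibre a) : proj (space_e (val t) + val x) == b.
Proof. by rewrite raddfD /= proj_e (eqP (valP x)) eq_sym (valP t). Qed.

Definition fibre_act (x : fibre a) : fibre b :=
  exist _ (space_e (val t) + val x) (fibre_act_over x).

Fact fibre_act_additive : GRing.nmod_morphism fibre_act.
Proof.
split=> [|x y]; apply: val_inj => /=.
  by rewrite -raddfD -(eqP (valP t)).
(* mu(e(r), e(r)) = e(r), so r_* is additive by the interchange law. *)
pose ee := pair_over (erefl (proj (space_e (val t)))).
have ee_e : space_mu ee = space_e (val t).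
  apply: etrans _ (slice_homP (ab_mu1l G) (space_e (val t))).
  by apply: space_mu_eq => //; exact: (congr1 space_e (esym (proj_e (val t)))).
rewrite -[X in X + _]ee_e -[LHS]raddfD.
exact: space_mu_eq.
Qed.

HB.instance Definition _ :=
  GRing.isNmodMorphism.Build (fibre a) (fibre b) fibre_act fibre_act_additive.
End FibreAction.

Definition fibre_group a : zmodType := fibre a.
Definition fibre_group_map a b (t : Hhom a b) :
  {additive fibre_group a -> fibre_group b} := fibre_act t.

Fact fibre_group_map_id a :
  fibre_group_map (Hidm a) = cm_idm (fibre_group a).
Proof. by apply: additive_eq => x; apply: val_inj; rewrite /= raddf0 add0r. Qed.

Fact fibre_group_map_comp a b c (t : Hhom b c) (s : Hhom a b) :
  fibre_group_map (Hcomp t s) = cm_comp (fibre_group_map t) (fibre_group_map s).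
Proof. by apply: additive_eq => x; apply: val_inj; rewrite /= raddfD addrA. Qed.

Definition fibre_system : systems M :=
  @Functor (Hcat M) Ab fibre_group fibre_group_map
    fibre_group_map_id fibre_group_map_comp.
End Fibres.

Section FibreMap.
Variables (M : nmodType) (G H : ab_object (cm_slice_products M)).
Variable f : ab_hom G H.

Definition space_map : {additive space G -> space H} := slice_fun (ab_map f).

Lemma proj_space_map x : proj H (space_map x) = proj G x.
Proof. exact: (additive_app (slice_over (ab_map f)) x). Qed.

Section AtPoint.
Variable a : M.

Fact fibre_map_over (x : fibre G a) : proj H (space_map (val x)) == a.
Proof. by rewrite proj_space_map (valP x). Qed.

Definition fibre_map (x : fibre G a) : fibre H a :=
  exist _ (space_map (val x)) (fibre_map_over x).

Fact fibre_map_additive : GRing.nmod_morphism fibre_map.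
Proof.
split=> [|x y]; apply: val_inj.
  exact: (slice_homP (ab_map_e f) a).
apply: etrans (slice_homP (ab_map_mu f) (pair_over (fibre_pair_over x y))) _.
exact: space_mu_eq.
Qed.

HB.instance Definition _ := GRing.isNmodMorphism.Build
  (fibre G a) (fibre H a) fibre_map fibre_map_additive.
End AtPoint.

Fact fibre_map_natural a b (t : Hhom a b) :
  cm_comp (fibre_map (a := b)) (fibre_group_map G t) =
  cm_comp (fibre_group_map H t) (fibre_map (a := a)).
Proof.
apply: additive_eq => x; apply: val_inj; rewrite /= raddfD; congr (_ + _).
exact: (slice_homP (ab_map_e f) (val t)).
Qed.

Definition fibre_system_map : hom (fibre_system G) (fibre_system H) :=
  @NatTrans (Hcat M) Ab (fibre_system G) (fibre_system H)
    (fun a => fibre_map (a := a) :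
       {additive fibre_group G a -> fibre_group H a})
    fibre_map_natural.
End FibreMap.

Section FibreFunctor.
Variable M : nmodType.
Local Notation AbOver := (ab_object_cat (cm_slice_products M)).

Fact fibre_system_map_id (G : AbOver) :
  fibre_system_map (idm G) = idm (fibre_system G).
Proof.
by apply: nat_trans_eq => a; apply: additive_eq => x; apply: val_inj.
Qed.

Fact fibre_system_map_comp (G H K : AbOver) (g : hom H K) (f : hom G H) :
  fibre_system_map (g \oc f) = fibre_system_map g \oc fibre_system_map f.
Proof.
by apply: nat_trans_eq => a; apply: additive_eq => x; apply: val_inj.
Qed.

Definition fibre_functor : functor AbOver (systems M) :=
  @Functor AbOver (systems M) (@fibre_system M) (@fibre_system_map M)
    fibre_system_map_id fibre_system_map_comp.
End FibreFunctor.

(** * The two constructions are mutually inverse *)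

Section FibreOfTotal.
Variables (M : nmodType) (A : systems M).

Definition to_fibre a (x : value A a) : fibre (total_ab A) a :=
  exist _ (point x) (eqxx a).

Fact to_fibre_additive a : GRing.nmod_morphism (@to_fibre a).
Proof.
split=> [|x y]; apply: val_inj => //=.
exact/esym/total_muE.
Qed.

HB.instance Definition _ a := GRing.isNmodMorphism.Build
  (value A a) (fibre (total_ab A) a) (@to_fibre a) (@to_fibre_additive a).

(** In [total], adding the zero of the fibre over [r] is applying [r_*]. *)
Fact to_fibre_natural a b (t : Hhom a b) :
  cm_comp (@to_fibre b) (act t) =
  cm_comp (fibre_group_map (total_ab A) t) (@to_fibre a).
Proof.
apply: additive_eq => x; apply: val_inj.
have ba : val t + a = 0 + b by rewrite add0r -(eqP (valP t)).
apply: (point_eq (t := arrow ba)) => //=.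
by rewrite raddf0 [RHS]add0r act_comp; apply: act_eq; rewrite /= add0r.
Qed.

Definition fibre_unit : hom A (fibre_functor M (total_functor M A)) :=
  @NatTrans (Hcat M) Ab A (fibre_system (total_ab A))
    (fun a => @to_fibre a : {additive value A a -> fibre_group (total_ab A) a})
    to_fibre_natural.

Lemma fibre_unit_invertible : invertible fibre_unit.
Proof.
apply: nat_trans_invertible => a.
pose to_base (u : fibre (total_ab A) a) : a = 0 + tag (val u) :=
  etrans (esym (eqP (valP u))) (esym (add0r _)).
pose g u := act (arrow (to_base u)) (tagged (val u)).
apply: (@Ab_invertible _ _ _ g).
  by move=> x; apply: act_loop.
move=> u; apply: val_inj; rewrite /g; move: (to_base u).
case: u => -[b x] /= _ ab.
by apply/esym/(point_eq (t := arrow ab)).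
Qed.

End FibreOfTotal.

Section TotalOfFibre.
Variables (M : nmodType) (G : ab_object (cm_slice_products M)).

Definition from_total (u : total (fibre_system G)) : space G :=
  val (tagged u : fibre G (tag u)).

Lemma proj_from_total u : proj G (from_total u) = tag u.
Proof. exact/eqP/(valP (tagged u : fibre G (tag u))). Qed.

(** The sum of the underlying monoid is recovered from the group law of a
    fibre, after both terms are moved there by the zero section: split the pair
    as [(x, e) + (e, y)] and use that [mu] is additive. *)
Lemma space_mu_shift (x y : space G) h :
  space_mu G (@pair_over M G (space_e G (proj G y) + x)
    (space_e G (proj G x) + y) h) = x + y.
Proof.
have x_x0 : proj G x = proj G (space_e G (proj G x)) by rewrite proj_e.
have y_0y : proj G (space_e G (proj G y)) = proj G y by rewrite proj_e.
rewrite -[X in _ = X + _](space_mu0r x_x0) -[X in _ = _ + X](space_mu0l y_0y).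
rewrite -[RHS]raddfD; apply: space_mu_eq => //=; exact: addrC.
Qed.

Fact from_total_additive : GRing.nmod_morphism from_total.
Proof.
split=> [|u v]; first exact: raddf0.
have h : proj G (space_e G (proj G (from_total v)) + from_total u) =
  proj G (space_e G (proj G (from_total u)) + from_total v).
  by rewrite !raddfD /= !proj_e addrC.
rewrite -(space_mu_shift h).
by apply: space_mu_eq; congr (space_e G _ + _); rewrite proj_from_total.
Qed.

HB.instance Definition _ := GRing.isNmodMorphism.Build
  (total (fibre_system G)) (space G) from_total from_total_additive.

Definition from_total_over :
  @hom (slice (M : CM)) (total_over (fibre_system G)) (ab_carrier G).
Proof.
exists (from_total : {additive total (fibre_system G) -> space G}).
by apply: additive_eq; exact: proj_from_total.
Defined.

Definition fibre_counit_map : ab_hom (total_ab (fibre_system G)) G.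
Proof.
exists from_total_over; apply: slice_hom_eq; apply: additive_eq.
- move=> w; have [a [x [y [wx wy]]]] := pairsP w.
  apply: etrans (congr1 from_total (total_muE wx wy)) _.
  apply: space_mu_eq.
    exact: (esym (congr1 from_total wx)).
  exact: (esym (congr1 from_total wy)).
- by [].
- by [].
Defined.

Lemma fibre_counit_invertible :
  @invertible (ab_object_cat _) _ _ fibre_counit_map.
Proof.
apply: ab_hom_invertible; apply: slice_hom_invertible.
pose locate (x : space G) : total (fibre_system G) :=
  @point _ (fibre_system G) (proj G x)
    (exist _ x (eqxx (proj G x)) : fibre G _).
apply: (CM_invertible (g := locate)) => // -[a [x xa]].
rewrite /locate /=.
by move: xa => /[dup] /eqP xa; case: a / xa => xa; congr point; apply: val_inj.
Qed.

End TotalOfFibre.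

Theorem proposition2p6 (M : nmodType) :
  equivalent (systems M) (ab_object_cat (cm_slice_products M)).
Proof.
exists (total_functor M), (fibre_functor M); split.
- have unit_nat (A B : systems M) (s : hom A B) :
    fibre_unit B \oc s =
    fmap (comp_functor (fibre_functor M) (total_functor M)) s \oc fibre_unit A.
    apply: nat_trans_eq => a; apply: additive_eq => x; exact: val_inj.
  pose unit := @NatTrans (systems M) (systems M) (id_functor _)
    (comp_functor (fibre_functor M) (total_functor M)) (@fibre_unit M) unit_nat.
  have := nat_trans_invertible (t := unit) (@fibre_unit_invertible M).
  by case/isomorphic_of_invertible.
- have counit_nat (G H : ab_object_cat (cm_slice_products M)) (f : hom G H) :
    (fibre_counit_map H : @hom (ab_object_cat _) _ _)
      \oc fmap (comp_functor (total_functor M) (fibre_functor M)) f =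
    f \oc (fibre_counit_map G : @hom (ab_object_cat _) _ _).
    by apply: ab_hom_eq; apply: slice_hom_eq; apply: additive_eq.
  pose counit := @NatTrans (ab_object_cat _) (ab_object_cat _)
    (comp_functor (total_functor M) (fibre_functor M)) (id_functor _)
    (@fibre_counit_map M) counit_nat.
  have := nat_trans_invertible (t := counit) (@fibre_counit_invertible M).
  by case/isomorphic_of_invertible.
Qed.
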